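(* Let $G$ be a finite group or a compact Lie group and let $\mathcal{R},\mathcal{L}$ be projective unitary representations of $G$ on a finite-dimensional Hilbert space $\mathcal{H}_B$ with inverse multipliers $\gamma$, $\gamma^{-1}$. Let $B=\{B^i\}$ be a tensor of square $D\times D$ matrices in canonical form II (CFII), $B^i=\bigoplus_{j=1}^m\bigoplus_{q=1}^{r_j}\mu_{j,q}B^i_j$, where $\{B_j\}$ is a basis of normal tensors (BNT) of $B$ consisting of normal tensors in CFII and $\mu_{j,q}$ are nonzero constants. Suppose $\mathcal{R}(g)^{[K]}\otimes\mathcal{L}(g)^{[K+1]}|\psi^N_B\rangle=|\psi^N_B\rangle$ for all $N\ge2$, all neighboring sites $K,K+1$ of the periodic chain and all $g\in G$, and let $X(g)=\bigoplus_{j=1}^m\bigoplus_{q=1}^{r_j}X_j(g)$ be a projective representation of $G$ with multiplier $\gamma$ such that $\sum_{i'}\mathcal{R}(g)_{i,i'}B^{i'}=B^iX(g)$ and $\sum_{i'}\mathcal{L}(g)_{i,i'}B^{i'}=X(g)^{-1}B^i$ for all $g,i$. Suppose in addition that $\operatorname{span}\{B^i\}_i$ contains the identity matrix. Let $A=\{A^i\}$ be a tensor of $D\times D$ matrices with physical space $\mathcal{H}_A$ and $\Theta$ a unitary representation of $G$ on $\mathcal{H}_A$ such that the matrix product vector generated by $AB$ has a local symmetry with respect to $\mathcal{R}(g)\otimes\Theta(g)\otimes\mathcal{L}(g)$: for all $N\ge2$, all sites $2K,2K+1,2K+2$ of the periodic chain of length $2N$ and all $g\in G$, $$\mathcal{R}(g)^{[2K]}\otimes\Theta(g)^{[2K+1]}\otimes\mathcal{L}(g)^{[2K+2]}|\psi^N_{AB}\rangle=|\psi^N_{AB}\rangle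 .$$ Then $|\psi^N_A\rangle$ has a global symmetry with respect to $\Theta$: $\Theta(g)^{\otimes N}|\psi^N_A\rangle=|\psi^N_A\rangle$ for all $N\in\mathbb{N}$ and $g\in G$. If in addition $A$ is in canonical form (CF) with the same block structure as $B$, i.e. $A^i=\bigoplus_{j=1}^m\bigoplus_{q=1}^{r_j}\nu_{j,q}A^i_j$ with $\{A_j\}$ a BNT of $A$, $A_j$ of the same matrix size as $B_j$, and $\nu_{j,q}$ nonzero constants, then for all $g\in G$ and all $i$ $$\sum_{i'}\Theta(g)_{i,i'}A^{i'}=X(g)^{-1}A^iX(g).$$
   Context: A multiplier of $G$ is a function $\gamma:G\times G\to U(1)$ with $\gamma(g,h)\gamma(gh,f)=\gamma(g,hf)\gamma(h,f)$ and $\gamma(g,e)=\gamma(e,g)=1$ (continuous if $G$ is a compact Lie group). A projective unitary representation with multiplier $\gamma$ is a map $\Theta$ from $G$ to unitaries with $\Theta(g)\Theta(h)=\gamma(g,h)\Theta(gh)$; unitary representations have trivial multiplier. All (projective) representations are finite dimensional. Matrix elements are taken in the orthonormal bases of $\mathcal{H}_A,\mathcal{H}_B$ labelling the tensors. A superscript $[K]$ indicates the site on which an operator acts. A tensor $A=\{A^i\}$ of square matrices generates $|\psi_A^N\rangle=\sum\operatorname{Tr}(A^{i_1}\cdots A^{i_N})|i_1\dots i_N\rangle$. Tensors $A,B$ generate $|\psi^N_{AB}\rangle=\sum\operatorname{Tr}(A^{i_1}B^{j_1}\cdots A^{i_N}B^{j_N})|i_1j_1\dots i_Nj_N\rangle$;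 odd sites carry $\mathcal{H}_A$, even sites carry $\mathcal{H}_B$, and sites are labelled modulo $2N$. The CP map associated with a tensor $B=\{B^i\}_{i=1}^d$ is $E_B(X)=\sum_{i=1}^dB^iX(B^i)^\dagger$. A tensor is normal if for some $L$ the $L$-fold products of its matrices span the full matrix algebra, and its CP map has spectral radius $1$. A tensor is in canonical form (CF) if it is of the form $\bigoplus_k\nu_kB_k^i$ with $B_k$ normal and $\nu_k$ constants; it is in CFII if in addition each $E_{B_k}$ is trace preserving and has a diagonal, positive definite fixed point. A basis of normal tensors (BNT) of a tensor $\bigoplus_k\nu_kB_k$ in CF is a set of normal tensors $\{\hat B_j\}$ such that for every $k$ there exist a unique $\hat B_j$, an invertible matrix $V$ and a phase $e^{i\phi}$ with $B_k^i=e^{i\phi}V^{-1}\hat B_j^iV$ for all $i$. *)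

(* Defs.v *)
From HB Require Import structures.
From mathcomp Require Import all_boot all_order all_algebra.
From mathcomp Require Import spectral.
From mathcomp Require Import complex.
From mathcomp Require Import all_classical all_reals all_analysis.

Set Implicit Arguments.
Unset Strict Implicit.
Unset Printing Implicit Defensive.

Import Order.TTheory GRing.Theory Num.Theory.
Import numFieldNormedType.Exports.

Local Open Scope classical_set_scope.
Local Open Scope sesquilinear_scope.
Local Open Scope complex_scope.
Local Open Scope ring_scope.

HB.mixin Record isTopologicalGroup G of Topological G & Group G := {
  mulg_continuous : continuous (fun p : G * G => (p.1 * p.2)%g) ;
  invg_continuous : continuous (fun x : G => (x^-1)%g)
}.

#[short(type="topologicalGroupType")]
HB.structure Definition TopologicalGroup :=
  {G of Topological G & Group G & isTopologicalGroup G}.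

(* On an open subset of a finite-dimensional space this is the usual C^k:
   f is differentiable and all its directional derivatives are C^(k-1). *)
Fixpoint Ck_on {R : realType} {V W : normedModType R} (k : nat) (U : set V)
    (f : V -> W) : Prop :=
  match k with
  | 0 => forall x, U x -> {for x, continuous f}
  | k'.+1 => (forall x, U x -> differentiable f x) /\
             (forall v : V, Ck_on k' U (fun x => 'D_v f x))
  end.

Definition smooth_on {R : realType} {V W : normedModType R} (U : set V)
    (f : V -> W) : Prop :=
  forall k, Ck_on k U f.

Section LieGroups.
Variables (R : realType) (G : topologicalGroupType).

(* chart_inv is only meaningful on the image of chart_dom by chart_map. *)
Record chart (n : nat) := Chart {
  chart_dom : set G ;
  chart_map : G -> 'rV[R]_n ;
  chart_inv : 'rV[R]_n -> G
}.

Definition chart_image n (c : chart n) : set 'rV[R]_n :=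
  chart_map c @` chart_dom c.

Definition is_chart n (c : chart n) : Prop :=
  [/\ open (chart_dom c), open (chart_image c),
      forall x, chart_dom c x -> chart_inv c (chart_map c x) = x,
      forall x, chart_dom c x -> {for x, continuous (chart_map c)} &
      forall u, chart_image c u -> {for u, continuous (chart_inv c)}].

Definition smooth_atlas n (atlas : set (chart n)) : Prop :=
  [/\ forall c, atlas c -> is_chart c,
      forall x : G, exists2 c, atlas c & chart_dom c x &
      forall c1 c2, atlas c1 -> atlas c2 ->
        smooth_on [set u | chart_image c1 u /\ chart_dom c2 (chart_inv c1 u)]
          (chart_map c2 \o chart_inv c1)].

Definition smooth_group_law n (atlas : set (chart n)) : Prop :=
  (forall c1 c2 c3, atlas c1 -> atlas c2 -> atlas c3 ->
     smooth_on
       [set p : 'rV[R]_n * 'rV[R]_n |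
          [/\ chart_image c1 p.1, chart_image c2 p.2 &
              chart_dom c3 (chart_inv c1 p.1 * chart_inv c2 p.2)%g]]
       (fun p => chart_map c3 (chart_inv c1 p.1 * chart_inv c2 p.2)%g)) /\
  (forall c1 c2, atlas c1 -> atlas c2 ->
     smooth_on
       [set u | chart_image c1 u /\ chart_dom c2 ((chart_inv c1 u)^-1)%g]
       (fun u => chart_map c2 ((chart_inv c1 u)^-1)%g)).

Definition lie_group : Prop :=
  [/\ hausdorff_space G, @second_countable G &
      exists n (atlas : set (chart n)),
        smooth_atlas atlas /\ smooth_group_law atlas].

Definition compact_lie_group : Prop := compact [set: G] /\ lie_group.

(* A finite group carries the discrete topology, so that continuity is no
   condition on functions defined on it. *)
Definition finite_discrete_group : Prop :=
  finite_set [set: G] /\ forall A : set G, open A.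

Definition finite_or_compact_lie_group : Prop :=
  finite_discrete_group \/ compact_lie_group.

End LieGroups.

Section Representations.
Variables (R : realType) (G : topologicalGroupType).
Local Notation C := R[i].

Definition multiplier (gamma : G -> G -> C) : Prop :=
  [/\ forall g h, `|gamma g h| = 1,
      forall g h f,
        gamma g h * gamma (g * h)%g f = gamma g (h * f)%g * gamma h f,
      forall g, gamma g 1%g = 1 /\ gamma 1%g g = 1 &
      continuous (fun p : G * G => gamma p.1 p.2 : C^o)].

Definition projective_rep n (gamma : G -> G -> C) (T : G -> 'M[C]_n) : Prop :=
  (forall g, T g \in unitmx) /\
  (forall g h, T g *m T h = gamma g h *: T (g * h)%g).

Definition projective_unitary_rep n (gamma : G -> G -> C)
    (T : G -> 'M[C]_n) : Prop :=
  (forall g, T g \is unitarymx) /\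
  (forall g h, T g *m T h = gamma g h *: T (g * h)%g).

Definition unitary_rep n (T : G -> 'M[C]_n) : Prop :=
  projective_unitary_rep (fun _ _ => 1) T.

End Representations.

Section Tensors.
Variable R : realType.
Local Notation C := R[i].

Definition tensor (d D : nat) := 'I_d -> 'M[C]_D.

Definition cp_map d D (B : tensor d D) (X : 'M[C]_D) : 'M[C]_D :=
  \sum_i B i *m X *m (B i)^t*.

(* [lin_mx E] is the matrix of the linear map E on 'M[C]_D. *)
Definition has_spectral_radius D (E : 'M[C]_D -> 'M[C]_D) (r : C) : Prop :=
  (exists2 a, eigenvalue (lin_mx E) a & `|a| = r) /\
  (forall a, eigenvalue (lin_mx E) a -> `|a| <= r).

Definition normal_tensor d D (B : tensor d D) : Prop :=
  (exists2 L : nat, (0 < L)%N &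
     (<<codom (fun w : L.-tuple 'I_d => \prod_(k < L) B (tnth w k))>>
        = fullv)%VS) /\
  has_spectral_radius (cp_map B) 1.

Definition trace_preserving D (E : 'M[C]_D -> 'M[C]_D) : Prop :=
  forall X, \tr (E X) = \tr X.

Definition CFII_block d D (B : tensor d D) : Prop :=
  [/\ normal_tensor B, trace_preserving (cp_map B) &
      exists2 v : 'rV[C]_D, (forall k, 0 < v 0 k) &
        cp_map B (diag_mx v) = diag_mx v].

(* V, V' are mutually inverse, which forces D1 = D2. *)
Definition gauge_equivalent d D1 D2 (B1 : tensor d D1) (B2 : tensor d D2)
    : Prop :=
  exists (z : C) (V : 'M[C]_(D2, D1)) (V' : 'M[C]_(D1, D2)),
    [/\ `|z| = 1, V *m V' = 1%:M, V' *m V = 1%:M &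
        forall i, B1 i = z *: (V' *m B2 i *m V)].

(* [Bblk] lists the normal blocks, with repetitions, of a tensor in canonical
   form, and [Bhat] is the basis. *)
Definition is_BNT d (K J : Type) (DK : K -> nat) (Bblk : forall k, tensor d (DK k))
    (DJ : J -> nat) (Bhat : forall j, tensor d (DJ j)) : Prop :=
  (forall j, normal_tensor (Bhat j)) /\
  (forall k, exists! j, gauge_equivalent (Bblk k) (Bhat j)).

Definition bdim m (r D : 'I_m -> nat) : nat := \sum_(j < m) \sum_(q < r j) D j.

Definition block_diag m (r D : 'I_m -> nat)
    (M : forall j, 'I_(r j) -> 'M[C]_(D j)) : 'M[C]_(bdim r D) :=
  \mxdiag_(j < m) \mxdiag_(q < r j) M j q.

Definition repeated_blocks d m (r D : 'I_m -> nat)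
    (Bs : forall j, tensor d (D j)) (k : {j : 'I_m & 'I_(r j)})
    : tensor d (D (tag k)) :=
  Bs (tag k).
Arguments repeated_blocks {d m} r {D} Bs k.

Definition in_CF d m (r D : 'I_m -> nat) (B : tensor d (bdim r D))
    (mu : forall j, 'I_(r j) -> C) (Bs : forall j, tensor d (D j)) : Prop :=
  [/\ forall j, (0 < r j)%N,
      forall j q, mu j q != 0,
      forall i, B i = block_diag (fun j q => mu j q *: Bs j i) &
      is_BNT (repeated_blocks r Bs) Bs].

Definition in_CFII d m (r D : 'I_m -> nat) (B : tensor d (bdim r D))
    (mu : forall j, 'I_(r j) -> C) (Bs : forall j, tensor d (D j)) : Prop :=
  in_CF B mu Bs /\ forall j, CFII_block (Bs j).

End Tensors.

Section States.
Variable R : realType.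
Local Notation C := R[i].

(* Vectors of the N-fold tensor power of C^d, by their coordinates in the
   product basis. *)
Definition state (d N : nat) := {ffun {ffun 'I_N -> 'I_d} -> C}.

(* Vectors of (H_A (x) H_B)^{(x) N}: a basis vector |i_1 j_1 ... i_N j_N> of
   the chain with 2N sites is encoded as the pair (i, j).  With indices
   counted from 0, the entry k of i sits at the odd site 2k+1 and the entry k
   of j at the even site 2k+2. *)
Definition state2 (dA dB N : nat) :=
  {ffun {ffun 'I_N -> 'I_dA} * {ffun 'I_N -> 'I_dB} -> C}.

Definition update d N (s : {ffun 'I_N -> 'I_d}) (K : 'I_N) (i : 'I_d)
    : {ffun 'I_N -> 'I_d} :=
  [ffun k => if k == K then i else s k].

(* O^{[K]} psi *)
Definition site_op d N (K : 'I_N) (O : 'M[C]_d) (psi : state d N)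
    : state d N :=
  [ffun s : {ffun 'I_N -> 'I_d} => \sum_i' O (s K) i' * psi (update s K i')].

Definition site_opA dA dB N (K : 'I_N) (O : 'M[C]_dA)
    (psi : state2 dA dB N) : state2 dA dB N :=
  [ffun s : {ffun 'I_N -> 'I_dA} * {ffun 'I_N -> 'I_dB} =>
     \sum_i' O (s.1 K) i' * psi (update s.1 K i', s.2)].

Definition site_opB dA dB N (K : 'I_N) (O : 'M[C]_dB)
    (psi : state2 dA dB N) : state2 dA dB N :=
  [ffun s : {ffun 'I_N -> 'I_dA} * {ffun 'I_N -> 'I_dB} =>
     \sum_j' O (s.2 K) j' * psi (s.1, update s.2 K j')].

(* O^{(x) N} psi *)
Definition global_op d N (O : 'M[C]_d) (psi : state d N) : state d N :=
  [ffun s : {ffun 'I_N -> 'I_d} => \sum_(s' : {ffun 'I_N -> 'I_d})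
     (\prod_k O (s k) (s' k)) * psi s'].

Definition mpv d D (A : tensor R d D) (N : nat) : state d N :=
  [ffun s : {ffun 'I_N -> 'I_d} => \tr (\prod_(k < N) A (s k))].

Definition mpv2 dA dB D (A : tensor R dA D) (B : tensor R dB D) (N : nat)
    : state2 dA dB N :=
  [ffun s : {ffun 'I_N -> 'I_dA} * {ffun 'I_N -> 'I_dB} =>
     \tr (\prod_(k < N) (A (s.1 k) *m B (s.2 k)))].

(* [ordS K] is K+1 modulo N. *)
Definition local_symmetry2 d D (B : tensor R d D) (O1 O2 : 'M[C]_d) : Prop :=
  forall (N : nat) (K : 'I_N), (2 <= N)%N ->
    site_op K O1 (site_op (ordS K) O2 (mpv B N)) = mpv B N.

(* The sites 2K, 2K+1, 2K+2 are an even, an odd and the next even site. *)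
Definition local_symmetry3 dA dB D (A : tensor R dA D) (B : tensor R dB D)
    (O1 : 'M[C]_dB) (T : 'M[C]_dA) (O2 : 'M[C]_dB) : Prop :=
  forall (N : nat) (K : 'I_N), (2 <= N)%N ->
    site_opB K O1 (site_opA (ordS K) T (site_opB (ordS K) O2 (mpv2 A B N)))
      = mpv2 A B N.

Definition global_symmetry d D (A : tensor R d D) (T : 'M[C]_d) : Prop :=
  forall N : nat, global_op T (mpv A N) = mpv A N.

End States.

(* Main.v *)
Require Import Defs.
From HB Require Import structures.
From mathcomp Require Import all_boot all_order all_algebra.
From mathcomp Require Import spectral.
From mathcomp Require Import complex.
From mathcomp Require Import all_classical all_reals all_analysis.

Set Implicit Arguments.
Unset Strict Implicit.
Unset Printing Implicit Defensive.

Import Order.TTheory GRing.Theory Num.Theory.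
Local Open Scope complex_scope.
Local Open Scope ring_scope.

(* Since 1 is in span {B^i}, contracting the B-sites with the coefficients of 1
   turns the local symmetry into identities between traces of words in the A^i:
   acting at one site, the letter A^i may be replaced by X (Theta A)^i X^-1,
   and acting at all sites the gauges cancel, which is the global symmetry for
   N >= 2.  For N = 1, matrices with equal power traces for all exponents >= 2
   have the same nonzero eigenvalues, hence the same trace.

   For the second part, the difference of X (Theta A)^i X^-1 and A^i is block
   diagonal with blocks nu_{j,q} delta_j and is trace-orthogonal to all nonempty
   words in A.  As the A_j are normal and pairwise not gauge equivalent, words of
   any large length L act on block j as an arbitrary matrix x and on the other
   blocks as 0, so (sum_q nu_{j,q}^(L+1)) tr (delta_j x) = 0; the power sum is
   nonzero for some such L, whence delta_j = 0. *)

(** * Power sums and traces of powers *)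

(* Evaluate a polynomial that vanishes at the nonzero [l i] and has nonzero
   constant term. *)
Lemma power_sum_descent (F : fieldType) (I : finType) (a l : I -> F) (n0 : nat) :
  (forall i, l i = 0 -> (0 < n0)%N) ->
  (forall n, (n0 < n)%N -> \sum_i a i * l i ^+ n = 0) ->
  \sum_i a i * l i ^+ n0 = 0.
Proof.
move=> l0 sum0; pose q := \prod_(i | l i != 0) ('X - (l i)%:P).
have qroot i : l i != 0 -> q.[l i] = 0.
  by move=> nz; rewrite /q horner_prod (bigD1 i) //= !hornerE subrr mul0r.
have q0 : q.[0] != 0.
  rewrite /q horner_prod; apply/prodf_neq0 => i nz.
  by rewrite !hornerE oppr_eq0.
have sizeq : size q = (size q).-1.+1.
  rewrite prednK // lt0n size_poly_eq0.
  by apply: contraNneq q0 => ->; rewrite horner0.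
have : \sum_i a i * l i ^+ n0 * q.[l i] = 0.
  apply: big1 => i _; have [li0|nz] := eqVneq (l i) 0; last first.
    by rewrite qroot // mulr0.
  by rewrite li0 expr0n gtn_eqF ?(l0 i) // mulr0 mul0r.
(* Expanding [q] raises the exponent by [k]; only [k = 0] escapes the assumption and leaves [q.[0]]
   times the wanted sum. *)
have -> : \sum_i a i * l i ^+ n0 * q.[l i] =
    \sum_(k < size q) q`_k * \sum_i a i * l i ^+ (n0 + k).
  under eq_bigr => i _ do rewrite horner_coef mulr_sumr.
  rewrite exchange_big; apply: eq_bigr => k _ /=.
  rewrite mulr_sumr; apply: eq_bigr => i _.
  by rewrite exprD mulrCA !mulrA.
rewrite sizeq big_ord_recl [X in _ + X]big1 ?addr0 => [|k _]; last first.
  by rewrite sum0 ?mulr0 // addnS ltnS leq_addr.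
by rewrite addn0 -horner_coef0 => /eqP; rewrite mulf_eq0 (negPf q0) => /eqP.
Qed.


Lemma is_trig_mxM (F : fieldType) n (S T : 'M[F]_n) :
  is_trig_mx S -> is_trig_mx T ->
  is_trig_mx (S *m T) /\ forall i, (S *m T) i i = S i i * T i i.
Proof.
move=> /is_trig_mxP trigS /is_trig_mxP trigT; split=> [|i].
  apply/is_trig_mxP => i j ltij; rewrite mxE big1 // => k _.
  have [ltik|leki] := ltnP i k; first by rewrite trigS ?mul0r.
  by rewrite trigT ?mulr0 // (leq_ltn_trans leki).
rewrite mxE (bigD1 i) //= big1 ?addr0 // => k neki.
have [ltik|ltki|/val_inj eik] := ltngtP i k; last by rewrite eik eqxx in neki.
  by rewrite trigS ?mul0r.
by rewrite trigT ?mulr0.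
Qed.

(** Schur triangularisation: powers of a triangular matrix have the powers of its diagonal entries
    on their diagonal. *)
Lemma mxtrace_exp_eigenvalues (C : numClosedFieldType) n (A : 'M[C]_n) :
  exists l : 'I_n -> C, forall k, \tr (A ^+ k) = \sum_i l i ^+ k.
Proof.
case: n A => [|n] A.
  by exists (fun=> 0) => k; rewrite /mxtrace !big_ord0.
have [P /unitarymx_unit uP] := Schur A (ltn0Sn n).
rewrite /similar_to conjumx // => trigT; set T := P *m A *m invmx P in trigT.
exists (fun i => T i i) => k.
have -> : \tr (A ^+ k) = \tr (T ^+ k).
  have -> : T ^+ k = P *m A ^+ k *m invmx P.
    elim: k => [|k IHk]; first by rewrite !expr0 mulmx1 mulmxV.
    by rewrite !exprS IHk -!mulmxE /T !mulmxA mulmxKV.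
  by rewrite mxtrace_mulC mulmxA mulVmx // mul1mx.
suff [_ diagT] : is_trig_mx (T ^+ k) /\ forall i, (T ^+ k) i i = T i i ^+ k.
  by apply: eq_bigr => i _; rewrite diagT.
elim: k => [|k [trigTk diagTk]].
  by rewrite expr0 scalar_mx_is_trig; split=> // i; rewrite mxE eqxx.
rewrite !exprS; have [? diagTS] := is_trig_mxM trigT trigTk.
by split=> // i; rewrite diagTS diagTk exprS.
Qed.

(** Descent to exponent 1 for the joint list of eigenvalues, weighted by 1 for [A] and -1 for [B];
    zero eigenvalues are harmless at a positive exponent. *)
Lemma eq_mxtrace_of_powers (C : numClosedFieldType) n (A B : 'M[C]_n) :
  (forall k, (1 < k)%N -> \tr (A ^+ k) = \tr (B ^+ k)) -> \tr A = \tr B.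
Proof.
have [a trA] := mxtrace_exp_eigenvalues A.
have [b trB] := mxtrace_exp_eigenvalues B => trAB.
pose c (u : 'I_n + 'I_n) : C := if u is inl _ then 1 else - 1.
pose l u := match u with inl i => a i | inr i => b i end.
have sumE k : \sum_u c u * l u ^+ k = \tr (A ^+ k) - \tr (B ^+ k).
  rewrite trA trB big_sumType /= -sumrN; congr (_ + _); apply: eq_bigr => i _.
    by rewrite mul1r.
  by rewrite mulN1r.
have := @power_sum_descent _ _ c l 1 (fun _ _ => isT).
rewrite sumE !expr1 => H; apply/eqP; rewrite -subr_eq0 H // => k k1.
by rewrite sumE trAB ?subrr.
Qed.

(** Otherwise descent would reach exponent 0, where the sum is the number of indices. *)
Lemma power_sum_neq0 (C : numFieldType) (I : finType) (l : I -> C) (n0 : nat) :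
  (0 < #|I|)%N -> (forall i, l i != 0) ->
  exists2 n, (n0 <= n)%N & \sum_i l i ^+ n != 0.
Proof.
move=> I0 lnz; apply: contrapT => ex0.
have : forall n, (n0 <= n)%N -> \sum_i l i ^+ n = 0.
  by move=> n le_n; apply/eqP; apply: contrapT => /negP s0; apply: ex0; exists n.
elim: n0 {ex0} => [|n0 IHn] sum0.
  have /eqP := sum0 0%N isT.
  by rewrite (eq_bigr (fun=> 1)) // sumr_const pnatr_eq0 gtn_eqF.
apply: IHn => n; rewrite leq_eqVlt => /orP[/eqP<-|]; last exact: sum0.
have := @power_sum_descent _ _ (fun=> 1) l n0.
under eq_bigr do rewrite mul1r; apply=> [i li0|n' ?].
  by move: (lnz i); rewrite li0 eqxx.
by under eq_bigr do rewrite mul1r; exact: sum0.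
Qed.

(** * Spans of words of a fixed length *)

Lemma memv_span_codom (F : fieldType) (vT : vectType F) (I : finType) (f : I -> vT) v :
  v \in <<codom f>>%VS -> exists b : I -> F, \sum_i b i *: f i = v.
Proof.
move=> vf; have /coord_span-> : v \in <<in_tuple (codom f)>>%VS by [].
pose P u := exists b : I -> F, \sum_i b i *: f i = u.
apply: (big_ind P) => [|_ _ [b <-] [b' <-]|k _].
- by exists (fun=> 0); rewrite big1 // => i _; rewrite scale0r.
- exists (fun i => b i + b' i); rewrite -big_split /=.
  by apply: eq_bigr => i _; rewrite scalerDl.
have /codomP[i ->] : (in_tuple (codom f))`_k \in codom f by rewrite mem_nth.
exists (fun i' => if i' == i then coord (in_tuple (codom f)) k v else 0).
by rewrite (bigD1 i) //= eqxx big1 ?addr0 // => i' /negPf->; rewrite scale0r.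
Qed.

Lemma delta_mx_sandwich (R : comNzRingType) m n p q (M : 'M[R]_(m, n))
    (l : 'I_p) (l' : 'I_q) a b :
  delta_mx l a *m M *m delta_mx b l' = M a b *: delta_mx l l'.
Proof.
transitivity (delta_mx l 0 *m (delta_mx (0 : 'I_1) a *m M *m delta_mx b (0 : 'I_1))
                *m delta_mx 0 l').
  by rewrite !mulmxA mul_delta_mx -!mulmxA mul_delta_mx !mulmxA.
rewrite -rowE -colE [col _ _]mx11_scalar mul_mx_scalar -scalemxAl mul_delta_mx.
by congr (_ *: _); rewrite !mxE.
Qed.

(** Matrix units suffice: [M E_ll = M E_l0 E_0l = E_l0 M E_0l], which is [M 0 0] times [E_ll]. *)
Lemma is_scalar_mx_of_comm (R : comNzRingType) n (M : 'M[R]_n) :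
  (forall x : 'M[R]_n, M *m x = x *m M) -> is_scalar_mx M.
Proof.
case: n M => [|n] M commM; first by rewrite [M]flatmx0 mx0_is_scalar.
apply/is_scalar_mxP; exists (M 0 0).
rewrite -[LHS]mulmx1 -[_%:M in RHS]scalemx1 mx1_sum_delta mulmx_sumr scaler_sumr.
apply: eq_bigr => l _.
by rewrite -delta_mx_sandwich -commM -mulmxA mul_delta_mx.
Qed.

Section WordSpan.
Variables (F : fieldType) (d : nat) (J : finType) (D : J -> nat).
Variable A : forall j, 'I_d -> 'M[F]_(D j).

(* Families [(x j)_j] that are linear combinations of words of length [L], with
   the same words and coefficients for all [j]. *)
Fixpoint word_span (L : nat) (x : forall j, 'M[F]_(D j)) : Prop :=
  match L with
  | 0 => exists c : F, forall j, x j = c%:M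
  | L'.+1 => exists y : 'I_d -> forall j, 'M[F]_(D j),
      (forall i, word_span L' (y i)) /\ (forall j, x j = \sum_i A j i *m y i j)
  end.

Lemma word_span_lin L a x y : word_span L x -> word_span L y ->
  word_span L (fun j => a *: x j + y j).
Proof.
elim: L x y => [|L IHL] x y /=.
  move=> [c xc] [e ye]; exists (a * c + e) => j.
  by rewrite xc ye scale_scalar_mx raddfD.
move=> [x' [spx' xE]] [y' [spy' yE]].
exists (fun i j => a *: x' i j + y' i j); split=> [i|j]; first exact: IHL.
rewrite xE yE scaler_sumr -big_split /=; apply: eq_bigr => i _.
by rewrite mulmxDr scalemxAr.
Qed.

Lemma word_span0 L : word_span L (fun j => 0).
Proof.
elim: L => [|L IHL] /=; first by exists 0 => j; rewrite raddf0.
exists (fun i j => 0); split=> // j; rewrite big1 // => i _; exact: mulmx0.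
Qed.

Lemma word_spanZ L a x : word_span L x -> word_span L (fun j => a *: x j).
Proof.
move=> spx; have := word_span_lin a spx (word_span0 L).
by congr word_span; apply/functional_extensionality_dep => j; rewrite addr0.
Qed.

Lemma word_span_sum (I : Type) (e : seq I) L (x : I -> forall j, 'M[F]_(D j)) :
  (forall i, word_span L (x i)) -> word_span L (fun j => \sum_(i <- e) x i j).
Proof.
move=> spx; elim: e => [|i e IHe].
  have := word_span0 L; congr word_span.
  by apply/functional_extensionality_dep => j; rewrite big_nil.
have := word_span_lin 1 (spx i) IHe; congr word_span.
by apply/functional_extensionality_dep => j; rewrite big_cons scale1r.
Qed.

Lemma word_spanM L L' x y : word_span L x -> word_span L' y ->
  word_span (L + L') (fun j => x j *m y j).
Proof.
elim: L x => [|L IHL] x /=.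
  move=> [c xc] /(word_spanZ c); congr word_span.
  by apply/functional_extensionality_dep => j; rewrite xc mul_scalar_mx.
move=> [x' [spx' xE]] spy.
exists (fun i j => x' i j *m y j); split=> [i|j]; first exact: IHL.
by rewrite xE mulmx_suml; apply: eq_bigr => i _; rewrite mulmxA.
Qed.

Lemma word_span_letter i : word_span 1 (fun j => A j i).
Proof.
exists (fun i' j => (i' == i)%:R%:M); split=> [i'|j].
  by exists (i' == i)%:R.
rewrite (bigD1 i) //= eqxx mulmx1 big1 ?addr0 // => i' /negPf->.
by rewrite raddf0 mulmx0.
Qed.

Lemma word_span_prod (w : seq 'I_d) :
  word_span (size w) (fun j => \prod_(i <- w) A j i).
Proof.
elim: w => [|i w IHw]; first by exists 1 => j; rewrite big_nil.
have := word_spanM (word_span_letter i) IHw; congr word_span.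
by apply/functional_extensionality_dep => j; rewrite big_cons.
Qed.

Definition full_at j L := forall x : 'M[F]_(D j), exists2 z, word_span L z & z j = x.

Lemma full_at_span j L :
  (<<codom (fun w : L.-tuple 'I_d => \prod_(k < L) A j (tnth w k))>> = fullv)%VS ->
  full_at j L.
Proof.
move=> spanf x; have := memvf x; rewrite -spanf => /memv_span_codom[b <-].
exists (fun j => \sum_w b w *: \prod_(i <- w) A j i).
  apply: word_span_sum => w; apply: word_spanZ.
  by rewrite -[L in word_span L](size_tuple w); exact: word_span_prod.
by apply: eq_bigr => w _; rewrite big_tuple.
Qed.

(** Write [1 = \sum_i A_i y_i], so that [x = \sum_i A_i (y_i x)], and reach each [y_i x] by words of
    length [L]. A first letter to split off exists as [L] is positive. *)
Lemma full_atS j L : (0 < L)%N -> full_at j L -> full_at j L.+1.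
Proof.
case: L => // L _ full x; have [z [y [_ zE]] zj] := full 1%:M.
have /boolp.choice[u uP] i : exists u, word_span L.+1 u /\ u j = y i j *m x.
  by have [u] := full (y i j *m x); exists u.
exists (fun j => \sum_i A j i *m u i j).
  by exists u; split=> // i; case: (uP i).
transitivity (z j *m x); last by rewrite zj mul1mx.
rewrite zE mulmx_suml; apply: eq_bigr => i _.
by case: (uP i) => _ ->; rewrite mulmxA.
Qed.

Lemma full_at_leq j L L' : (0 < L <= L')%N -> full_at j L -> full_at j L'.
Proof.
move=> /andP[L0] /subnK <- full; elim: (_ - _)%N => // n IHn.
by rewrite addSn; apply: full_atS; rewrite // addn_gt0 L0 orbT.
Qed.

(** * Separating blocks by words, and intertwiners between blocks *)

Definition words_separate j k := exists L z,
  [/\ word_span L z, z j = 1%:M & z k = 0].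

(** A nonzero matrix generates the full algebra as a two-sided ideal: [\sum_l E_la M E_bl = M_ab 1].
    The same products vanish at [k]. *)
Lemma words_separate_of_neq0 j k L0 L z : full_at j L0 ->
  word_span L z -> z k = 0 -> z j != 0 -> words_separate j k.
Proof.
move=> full spz zk; rewrite -subr_eq0 subr0 => zj.
have /matrix0Pn[a [b zab]] := zj.
have /boolp.choice[u uP] l :
    exists u, word_span L0 u /\ u j = (z j a b)^-1 *: delta_mx l a.
  by have [u] := full ((z j a b)^-1 *: delta_mx l a); exists u.
have /boolp.choice[v vP] l : exists v, word_span L0 v /\ v j = delta_mx b l.
  by have [v] := full (delta_mx b l); exists v.
exists (L0 + L + L0)%N, (fun j => \sum_l u l j *m z j *m v l j); split.
- apply: word_span_sum => l; apply: word_spanM; last by case: (vP l).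
  by apply: word_spanM => //; case: (uP l).
- rewrite mx1_sum_delta; apply: eq_bigr => l _.
  have [_ ->] := uP l; have [_ ->] := vP l.
  by rewrite -!scalemxAl delta_mx_sandwich scalerA mulVf ?scale1r.
- by rewrite big1 // => l _; rewrite zk mulmx0 mul0mx.
Qed.

(** With [z] equal to 1 at [k] and 0 at [j], take [u] equal to 1 at [j] and [v] equal to [u k] at
    [k]: then [u - z v] is 1 at [j] and 0 at [k]. The length of [u] is chosen to match that of
    [z v]. *)
Lemma words_separate_sym j k L0 : (forall L, (L0 <= L)%N -> full_at j L) ->
  full_at k L0 -> words_separate k j -> words_separate j k.
Proof.
move=> fullj fullk [L [z [spz zk zj]]].
have [u spu uj] := fullj (L + L0)%N (leq_addl _ _) 1%:M.
have [v spv vk] := fullk (u k).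
exists (L + L0)%N, (fun j => -1 *: (z j *m v j) + u j); split.
- by apply: word_span_lin spu; exact: word_spanM.
- by rewrite zj mul0mx scaler0 add0r.
- by rewrite zk mul1mx vk scaleN1r addNr.
Qed.

Lemma word_span_intertwine j k (c : F) (V : 'M[F]_(D k, D j)) :
  (forall i, A k i *m V = c *: (V *m A j i)) ->
  forall L z, word_span L z -> z k *m V = c ^+ L *: (V *m z j).
Proof.
move=> AV; elim=> [|L IHL] z /=.
  by move=> [e ze]; rewrite !ze scale1r mul_scalar_mx mul_mx_scalar.
move=> [y [spy zE]]; rewrite !zE mulmx_suml mulmx_sumr scaler_sumr.
apply: eq_bigr => i _; rewrite -mulmxA IHL // -scalemxAr !mulmxA AV.
by rewrite -scalemxAl scalerA exprSr.
Qed.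

(* If the words of length [L] acting at [j] and at [k] cannot be separated, then
   the values at [j] and at [k] of the elements of [word_span L] determine each
   other, and sending the matrix units of the first column at [j] to their
   partners at [k], applied to a vector, defines an intertwiner. *)
Lemma intertwiner_of_not_words_separate j k L0 : (0 < D j)%N ->
  (forall L, (L0 <= L)%N -> full_at j L) ->
  (forall L, (L0 <= L)%N -> full_at k L) -> ~ words_separate j k ->
  exists2 c : F, c != 0 & exists V : 'M[F]_(D k, D j),
    V != 0 /\ forall i, A k i *m V = c *: (V *m A j i).
Proof.
move=> Dj fullj fullk nsep.
have eq0k L z : word_span L z -> z j = 0 -> z k = 0.
  move=> spz zj; apply/eqP; apply: contrapT => /negP zk; apply: nsep.
  apply: (words_separate_sym fullj) (fullk _ (leqnn _)) _.
  exact: words_separate_of_neq0 (fullk _ (leqnn _)) spz zj zk.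
have eq0j L z : word_span L z -> z k = 0 -> z j = 0.
  move=> spz zk; apply/eqP; apply: contrapT => /negP zj; apply: nsep.
  exact: words_separate_of_neq0 (fullj _ (leqnn _)) spz zk zj.
have eqk L z z' : word_span L z -> word_span L z' -> z j = z' j -> z k = z' k.
  move=> spz spz' zz'; apply/eqP; rewrite -subr_eq0; apply/eqP.
  have := eq0k _ _ (word_span_lin (-1) spz' spz).
  by rewrite /= !scaleN1r !(addrC (- _)) zz' subrr; apply.
have one_neq0 : 1%:M != 0 :> 'M[F]_(D j).
  apply/eqP => /matrixP/(_ (Ordinal Dj) (Ordinal Dj))/eqP.
  by rewrite !mxE eqxx oner_eq0.
(* The partner at [k] of the identity at [j] commutes with all matrices, hence is a scalar. *)
have scalar_k L e : word_span L e -> e j = 1%:M ->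
    exists2 c, c != 0 & e k = c%:M.
  move=> spe ej.
  have /is_scalar_mxP[c ec] : is_scalar_mx (e k).
    apply: is_scalar_mx_of_comm => x; have [z spz <-] := fullk L0 (leqnn _) x.
    apply: (eqk (L + L0)%N (fun j => e j *m z j) (fun j => z j *m e j)).
    - exact: word_spanM.
    - by rewrite addnC; exact: word_spanM.
    - by rewrite ej mul1mx mulmx1.
  exists c => //; apply: contraNneq one_neq0 => c0.
  by rewrite -ej (eq0j _ _ spe) // ec c0 raddf0.
(* Two representatives of the identity at [j], of lengths [L0] and [L0 + 1], serve as padding: a
   letter times [u l] is one letter longer than [u p]. Their scalars at [k] give [c' / c]. *)
have [e spe ej] := fullj L0 (leqnn _) 1%:M.
have [e' spe' e'j] := fullj L0.+1 (leqnSn _) 1%:M.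
have [c cn0 ek] := scalar_k _ _ spe ej.
have [c' c'n0 e'k] := scalar_k _ _ spe' e'j.
pose o := Ordinal Dj.
have /boolp.choice[u uP] l : exists u, word_span L0 u /\ u j = delta_mx l o.
  by have [u] := fullj L0 (leqnn _) (delta_mx l o); exists u.
have [a [b uab]] : exists a b, u o k a b != 0.
  apply/matrix0Pn; apply/eqP => uk0; have [spu uj] := uP o.
  have := eq0j _ _ spu uk0; rewrite uj => /matrixP/(_ o o)/eqP.
  by rewrite !mxE !eqxx oner_eq0.
exists (c' / c); first by rewrite mulf_neq0 ?invr_eq0.
pose V : 'M[F]_(D k, D j) := \matrix_(p, l) u l k p b.
exists V; split; first by apply/matrix0Pn; exists a, o; rewrite mxE.
move=> i.
(* Both sides come from words of length [2 L0 + 1] with equal values at [j], since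
   [A E_lo = \sum_p A_pl E_po]. *)
have key l : c *: (A k i *m u l k) = c' *: \sum_p A j i p l *: u p k.
  have [spu uj] := uP l.
  rewrite -!mul_mx_scalar -ek -e'k.
  apply: (eqk (L0 + L0.+1)%N (fun j' => A j' i *m u l j' *m e j')
    (fun j' => (\sum_p A j i p l *: u p j') *m e' j')).
  - rewrite addnS -addSn -add1n; apply: word_spanM spe.
    exact: word_spanM (word_span_letter i) spu.
  - apply: word_spanM spe'; apply: word_span_sum => p.
    by apply: word_spanZ; case: (uP p).
  - rewrite ej e'j !mulmx1 uj; apply/matrixP => p q.
    rewrite !mxE summxE (bigD1 l) //= big1 ?addr0 => [|p' /negPf np']; last first.
      by rewrite mxE np' mulr0.
    rewrite mxE eqxx (bigD1 p) //= big1 ?addr0 => [|p' np'].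
      by have [_ ->] := uP p; rewrite !mxE eqxx.
    by have [_ ->] := uP p'; rewrite !mxE eq_sym (negPf np') mulr0.
apply: (scalerI cn0); rewrite scalerA mulrCA divff // mulr1.
apply/matrixP => p l; have := congr1 (fun M : 'M[F]_(D k) => M p b) (key l).
rewrite !mxE summxE => keyE; under eq_bigr do rewrite mxE.
by rewrite keyE; congr (_ * _); apply: eq_bigr => q _; rewrite !mxE mulrC.
Qed.

(** Schur's lemma: the left kernels of [V] and of its transpose are invariant under a full matrix
    algebra, so a nonzero vector in either would force [V = 0]. *)
Lemma intertwiner_invertible j k L (c : F) (V : 'M[F]_(D k, D j)) :
  full_at j L -> full_at k L -> c != 0 -> V != 0 ->
  (forall i, A k i *m V = c *: (V *m A j i)) ->
  exists V', V *m V' = 1%:M /\ V' *m V = 1%:M.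
Proof.
move=> fullj fullk cn0 Vn0 AV.
have delta00 : delta_mx 0 0 = 1%:M :> 'M[F]_1 by rewrite mx1_sum_delta big_ord1.
have inter := word_span_intertwine AV.
have freeV : row_free V.
  rewrite -kermx_eq0; apply: contraNT Vn0 => /rowV0Pn[w /sub_kermxP wV wn0].
  have [p wp] : exists p, w 0 p != 0 by apply/rV0Pn.
  apply/eqP/row_matrixP => q; rewrite row0 rowE.
  have [z spz zk] := fullk (delta_mx p q).
  have := congr1 (mulmx w) (inter _ _ spz).
  rewrite zk -scalemxAr !mulmxA wV mul0mx scaler0.
  have -> : w *m delta_mx p q = w 0 p *: delta_mx 0 q.
    by rewrite -delta_mx_sandwich delta00 mul1mx.
  by rewrite -scalemxAl => /eqP; rewrite scaler_eq0 (negPf wp) => /eqP.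
have freeVT : row_free V^T.
  rewrite -kermx_eq0; apply: contraNT Vn0 => /rowV0Pn[w /sub_kermxP wV wn0].
  have [p wp] : exists p, w 0 p != 0 by apply/rV0Pn.
  rewrite -trmx_eq0; apply/eqP/row_matrixP => q; rewrite row0 rowE.
  have [z spz zj] := fullj (delta_mx q p).
  have := congr1 (fun M => w *m M^T) (inter _ _ spz).
  rewrite zj trmx_mul mulmxA wV mul0mx linearZ /= -scalemxAr trmx_mul trmx_delta mulmxA.
  have -> : w *m delta_mx p q = w 0 p *: delta_mx 0 q.
    by rewrite -delta_mx_sandwich delta00 mul1mx.
  rewrite -scalemxAl scalerA => /esym/eqP.
  by rewrite scaler_eq0 mulf_eq0 expf_eq0 (negPf cn0) andbF (negPf wp) => /eqP.
have [V' VV'] := row_freeP freeV.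
have /row_fullP[V'' V''V] : row_full V.
  by rewrite /row_full -mxrank_tr; exact: freeVT.
exists V'; split=> //.
suff -> : V' = V'' by [].
by rewrite -[V'']mulmx1 -VV' mulmxA V''V mul1mx.
Qed.

(** The product of the separators of [j] from all other indices is 1 at [j] and 0 elsewhere; words
    of the remaining length, at least [L0], then supply [x]. *)
Lemma isolated_span j L0 : (forall L, (L0 <= L)%N -> full_at j L) ->
  (forall k, k != j -> words_separate j k) ->
  exists L1, forall L, (L1 <= L)%N -> forall x : 'M[F]_(D j),
    exists z, [/\ word_span L z, z j = x & forall k, k != j -> z k = 0].
Proof.
move=> fullj sepj.
suff [L1 [e [spe ej ek]]] : exists L z, [/\ word_span L z, z j = 1%:M &
    forall k, k \in enum (predC1 j) -> z k = 0].
  exists (L1 + L0)%N => L leL x.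
  have [|z spz zj] := fullj (L - L1)%N _ x.
    by rewrite leq_subRL // (leq_trans _ leL) ?leq_addr.
  exists (fun k => e k *m z k); split=> [||k nekj].
  - by rewrite -(subnKC (leq_trans (leq_addr _ _) leL)); exact: word_spanM.
  - by rewrite ej mul1mx.
  - by rewrite ek ?mul0mx // mem_enum.
have : {in enum (predC1 j), forall k, words_separate j k}.
  by move=> k; rewrite mem_enum; exact: sepj.
elim: (enum _) => [_|k ks IHks sepks].
  by exists 0%N, (fun=> 1%:M); split=> //; exists 1.
have [L [z [spz zj zk]]] := sepks k (mem_head _ _).
have [|L' [z' [spz' z'j z'k]]] := IHks.
  by move=> k' k'ks; apply: sepks; rewrite in_cons k'ks orbT.
exists (L + L')%N, (fun j => z j *m z' j); split.
- exact: word_spanM.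
- by rewrite zj z'j mulmx1.
- move=> k'; rewrite in_cons => /orP[/eqP->|k'ks]; first by rewrite zk mul0mx.
  by rewrite z'k ?mulmx0.
Qed.

End WordSpan.

(** * Normal tensors *)

Section NormalTensors.
Variable R : realType.
Local Notation C := R[i].

Lemma cp_map_is_linear d D (B : tensor R d D) : linear (cp_map B).
Proof.
move=> a X Y; rewrite /cp_map scaler_sumr -big_split /=; apply: eq_bigr => i _.
by rewrite mulmxDr mulmxDl -scalemxAr -scalemxAl.
Qed.

HB.instance Definition _ d D (B : tensor R d D) :=
  GRing.isLinear.Build C _ _ _ (cp_map B) (cp_map_is_linear B).

Lemma eigenvalue_cp_map d D (B : tensor R d D) (a : C) :
  eigenvalue (lin_mx (cp_map B)) a <->
  exists2 X, X != 0 & cp_map B X = a *: X.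
Proof.
split=> [/eigenvalueP[v vE v0]|[X X0 XE]].
  exists (vec_mx v); first by rewrite vec_mx_eq0.
  by rewrite -mx_rV_lin vE linearZ.
apply/eigenvalueP; exists (mxvec X); last by rewrite mxvec_eq0.
by rewrite mul_vec_lin /= XE linearZ.
Qed.

(** If [Y] is an eigenvector of the map of [B2] with eigenvalue [a] of modulus 1, then [V' Y] times
    the adjoint of [V'] is one for [B1] with eigenvalue [|z|^2 a], bounded by the spectral
    radius. *)
Lemma norm_gauge_scalar_le1 d D1 D2 (B1 : tensor R d D1) (B2 : tensor R d D2)
    (z : C) (V : 'M[C]_(D2, D1)) (V' : 'M[C]_(D1, D2)) :
  has_spectral_radius (cp_map B1) 1 -> has_spectral_radius (cp_map B2) 1 ->
  V *m V' = 1%:M -> V' *m V = 1%:M ->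
  (forall i, B1 i = z *: (V' *m B2 i *m V)) -> `|z| <= 1.
Proof.
move=> [_ le1] [[a /eigenvalue_cp_map[Y Y0 YE] a1] _] VV' V'V B1E.
pose X := V' *m Y *m map_mx Num.conj (trmx V').
have VX : V *m X *m map_mx Num.conj (trmx V) = Y.
  rewrite /X !mulmxA VV' mul1mx -mulmxA -map_mxM -trmx_mul VV'.
  by rewrite trmx1 map_mx1 mulmx1.
have : eigenvalue (lin_mx (cp_map B1)) (`|z| ^+ 2 * a).
  apply/eigenvalue_cp_map; exists X.
    by apply: contraNneq Y0 => X0; rewrite -VX X0 mulmx0 mul0mx.
  transitivity (`|z| ^+ 2 *: (V' *m cp_map B2 Y *m map_mx Num.conj (trmx V'))).
    rewrite /cp_map mulmx_sumr mulmx_suml scaler_sumr; apply: eq_bigr => i _.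
    rewrite B1E linearZ /= map_mxZ !trmx_mul !map_mxM /= -scalemxAr -!scalemxAl.
    rewrite scalerA normCK mulrC -VX; congr (_ *: _).
    by rewrite !mulmxA.
  by rewrite YE -scalemxAr -scalemxAl scalerA.
move=> /le1; rewrite normrM a1 mulr1 normrX normr_id.
by rewrite expr_le1.
Qed.

Lemma gauge_equivalent_refl d D1 (B1 : tensor R d D1) : gauge_equivalent B1 B1.
Proof.
exists 1, 1%:M, 1%:M; split; rewrite ?mulmx1 ?normr1 // => i.
by rewrite mulmx1 mul1mx scale1r.
Qed.

Lemma normal_tensor_dim_gt0 d D1 (B1 : tensor R d D1) : normal_tensor B1 -> (0 < D1)%N.
Proof.
move=> [_ [[a /eigenvalue_cp_map[X X0 _] _] _]]; rewrite lt0n.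
by apply: contraNneq X0 => D0; move: X; rewrite D0 => X; rewrite [X]flatmx0.
Qed.

Section Family.
Variables (d : nat) (J : finType) (D : J -> nat) (A : forall j, tensor R d (D j)).
Hypothesis normalA : forall j, normal_tensor (A j).

Lemma normal_full_at j :
  exists L0, forall L, (L0 <= L)%N -> full_at A j L.
Proof.
have [[L L0 /full_at_span full] _] := normalA j.
by exists L => // L' leL; apply: (full_at_leq _ full); rewrite L0.
Qed.

(** Without separation there is a nonzero intertwiner, which is invertible; comparing spectral radii
    in both directions makes its scalar a phase. *)
Lemma normal_words_separate j k :
  ~ gauge_equivalent (A j) (A k) -> words_separate A j k.
Proof.
move=> ngauge; apply: contrapT => nsep; apply: ngauge.
have [L1 full1] := normal_full_at j; have [L2 full2] := normal_full_at k.
pose L0 := maxn L1 L2.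
have fullj L : (L0 <= L)%N -> full_at A j L by rewrite geq_max => /andP[/full1].
have fullk L : (L0 <= L)%N -> full_at A k L by rewrite geq_max => /andP[_ /full2].
have [c cn0 [V [Vn0 AV]]] :=
  intertwiner_of_not_words_separate (normal_tensor_dim_gt0 (normalA j))
    fullj fullk nsep.
have [V' [VV' V'V]] :=
  intertwiner_invertible (fullj _ (leqnn _)) (fullk _ (leqnn _)) cn0 Vn0 AV.
have AjE i : A j i = c^-1 *: (V' *m A k i *m V).
  by rewrite -mulmxA AV -scalemxAr scalerA mulVf // scale1r mulmxA V'V mul1mx.
have AkE i : A k i = c *: (V *m A j i *m V').
  by rewrite scalemxAl -AV -mulmxA VV' mulmx1.
exists c^-1, V, V'; split=> //; apply/eqP; rewrite eq_le.
have [[_ radj] [_ radk]] := (normalA j, normalA k).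
rewrite (norm_gauge_scalar_le1 radj radk VV' V'V AjE) /=.
rewrite normfV -[1]invr1 lef_pV2 ?posrE ?normr_gt0 //.
exact: norm_gauge_scalar_le1 radk radj V'V VV' AkE.
Qed.
End Family.
End NormalTensors.

(** * From local to global symmetries *)

Lemma prod_lincomb_at (R : comNzRingType) D (I : eqType) (J : finType) (e : seq I)
    (F : I -> 'M[R]_D) (K : I) (c : J -> R) (M : J -> 'M[R]_D) :
  uniq e -> K \in e -> F K = \sum_j c j *: M j ->
  \prod_(k <- e) F k
    = \sum_j c j *: \prod_(k <- e) (if k == K then M j else F k).
Proof.
move=> + + FK; elim: e => // k e IHe /= /andP[k_notin uniq_e].
rewrite in_cons big_cons => /orP[/eqP eKk|Ke].
  rewrite -eKk FK mulr_suml; apply: eq_bigr => j _.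
  rewrite big_cons eqxx -!mulmxE -scalemxAl; congr (_ *: (_ *m _)).
  apply: eq_big_seq => l le; rewrite ifN //.
  by apply: contraNneq k_notin => lK; rewrite -eKk -lK.
rewrite IHe // mulr_sumr; apply: eq_bigr => j _.
rewrite big_cons ifN; first by rewrite -!mulmxE -scalemxAr.
by apply: contraNneq k_notin => ->.
Qed.

Lemma prod_scale (R : comNzRingType) D (I : Type) (e : seq I)
    (c : I -> R) (M : I -> 'M[R]_D) :
  \prod_(k <- e) (c k *: M k) = (\prod_(k <- e) c k) *: \prod_(k <- e) M k.
Proof.
elim: e => [|k e IHe]; first by rewrite !big_nil scale1r.
by rewrite !big_cons IHe -!mulmxE -scalemxAl -scalemxAr scalerA.
Qed.

Section LocalToGlobal.
Variable R : realType.
Local Notation C := R[i].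

Definition tensor_act d D (T : 'M[C]_d) (A : tensor R d D) : tensor R d D :=
  fun i => \sum_i' T i i' *: A i'.

(** Tensors may vary from site to site, so that an operator acting at one site yields a state of the
    same form. *)
Definition mpv_sites dA dB D N (Z : 'I_N -> tensor R dA D)
    (W : 'I_N -> tensor R dB D) : state2 R dA dB N :=
  [ffun s : {ffun 'I_N -> 'I_dA} * {ffun 'I_N -> 'I_dB} =>
     \tr (\prod_k (Z k (s.1 k) *m W k (s.2 k)))].

Lemma site_opA_mpv_sites dA dB D N (K : 'I_N) (T : 'M[C]_dA)
    (Z Z' : 'I_N -> tensor R dA D) (W : 'I_N -> tensor R dB D) :
  (forall i, Z' K i = tensor_act T (Z K) i) ->
  (forall k i, k != K -> Z' k i = Z k i) ->
  site_opA K T (mpv_sites Z W) = mpv_sites Z' W.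
Proof.
move=> Z'K Z'k; apply/ffunP => s; rewrite !ffunE.
rewrite (@prod_lincomb_at _ _ _ _ _ _ K (T (s.1 K))
  (fun i' => Z K i' *m W K (s.2 K))) ?index_enum_uniq ?mem_index_enum //; last first.
  by rewrite Z'K mulmx_suml; apply: eq_bigr => i' _; rewrite scalemxAl.
rewrite raddf_sum; apply: eq_bigr => i' _ /=; rewrite linearZ /= !ffunE /=.
congr (_ * \tr _); apply: eq_bigr => k _; rewrite !ffunE.
by case: eqP => [->//|/eqP nekK]; rewrite Z'k.
Qed.

Lemma site_opB_mpv_sites dA dB D N (K : 'I_N) (T : 'M[C]_dB)
    (Z : 'I_N -> tensor R dA D) (W W' : 'I_N -> tensor R dB D) :
  (forall i, W' K i = tensor_act T (W K) i) ->
  (forall k i, k != K -> W' k i = W k i) ->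
  site_opB K T (mpv_sites Z W) = mpv_sites Z W'.
Proof.
move=> W'K W'k; apply/ffunP => s; rewrite !ffunE.
rewrite (@prod_lincomb_at _ _ _ _ _ _ K (T (s.2 K))
  (fun i' => Z K (s.1 K) *m W K i')) ?index_enum_uniq ?mem_index_enum //; last first.
  by rewrite W'K mulmx_sumr; apply: eq_bigr => i' _; rewrite scalemxAr.
rewrite raddf_sum; apply: eq_bigr => i' _ /=; rewrite linearZ /= !ffunE /=.
congr (_ * \tr _); apply: eq_bigr => k _; rewrite !ffunE.
by case: eqP => [->//|/eqP nekK]; rewrite W'k.
Qed.

(** The trace thus depends on the state alone: equal states give equal traces even when their
    tensors differ. *)
Lemma contract_mpv_sites dA dB D N (Z : 'I_N -> tensor R dA D)
    (W : 'I_N -> tensor R dB D) (b : 'I_dB -> C) (s : {ffun 'I_N -> 'I_dA}) :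
  \tr (\prod_k (Z k (s k) *m \sum_j b j *: W k j))
    = \sum_(t : {ffun 'I_N -> 'I_dB}) (\prod_k b (t k)) * mpv_sites Z W (s, t).
Proof.
under eq_bigr => k _ do rewrite mulmx_sumr.
rewrite bigA_distr_bigA raddf_sum; apply: eq_bigr => t _ /=.
rewrite ffunE /= -mxtraceZ -prod_scale; congr (\tr _).
by apply: eq_bigr => k _; rewrite scalemxAr.
Qed.

(** * Applying the local symmetry at several sites *)

Section Symmetry.
Variables (dA dB D : nat) (A : tensor R dA D) (B : tensor R dB D).
Variables (O1 O2 : 'M[C]_dB) (T : 'M[C]_dA) (X Y : 'M[C]_D) (b : 'I_dB -> C).
Hypothesis actO1 : forall i, tensor_act O1 B i = B i *m X.
Hypothesis actO2 : forall i, tensor_act O2 B i = Y *m B i.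
Hypothesis b_id : \sum_j b j *: B j = 1%:M.
Hypothesis sym : local_symmetry3 A B O1 T O2.

Let sel (p : bool) (M : 'M[C]_D) := if p then M else 1%:M.
(** [e] lists the sites [K] at which the symmetry has been applied. Each puts [X] to the right of
    [B] at [K]; at the next site it transforms [A] and puts [Y] to the left of [B], hence the tests
    on [ord_pred k]. *)
Let ZA N (e : seq 'I_N) k := if ord_pred k \in e then tensor_act T A else A.
Let WB N (e : seq 'I_N) k : tensor R dB D :=
  fun j => sel (ord_pred k \in e) Y *m B j *m sel (k \in e) X.

Lemma iter_local_symmetry N (e : seq 'I_N) : (2 <= N)%N -> uniq e ->
  mpv_sites (ZA e) (WB e) = mpv2 A B N.
Proof.
move=> N2; elim: e => [_|K e IHe /= /andP[Ke uniq_e]].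
  apply/ffunP => s; rewrite !ffunE; congr (\tr _); apply: eq_bigr => k _.
  by rewrite /ZA /WB /sel /= mul1mx mulmx1.
rewrite -(sym K N2) -IHe //.
have ord_predE k : (ord_pred k == K) = (k == ordS K).
  by apply/eqP/eqP => [<-|->]; rewrite ?ord_predK ?ordSK.
(* The intermediate stage: [O2] has acted at [ordS K], but [O1] not yet at [K]. *)
pose W1 k : tensor R dB D :=
  fun j => sel (ord_pred k \in K :: e) Y *m B j *m sel (k \in e) X.
rewrite (@site_opB_mpv_sites _ _ _ _ _ _ _ _ W1); first last.
- by move=> k i neqk; rewrite /W1 /WB in_cons ord_predE (negPf neqk).
- move=> i; rewrite /W1 in_cons ordSK eqxx /=.
  rewrite /tensor_act /WB ordSK (negPf Ke) /= -actO2 mulmx_suml.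
  by apply: eq_bigr => i' _; rewrite mul1mx scalemxAl.
rewrite (@site_opA_mpv_sites _ _ _ _ _ _ _ (ZA (K :: e))); first last.
- by move=> k i neqk; rewrite /ZA in_cons ord_predE (negPf neqk).
- by move=> i; rewrite /ZA in_cons ordSK eqxx /= (negPf Ke).
rewrite (@site_opB_mpv_sites _ _ _ _ _ _ _ _ (WB (K :: e))) //.
- move=> i; rewrite /WB [K \in _ :: _]in_cons eqxx /= -mulmxA -actO1 mulmx_sumr.
  apply: eq_bigr => i' _.
  by rewrite /W1 (negPf Ke) /= mulmx1 -scalemxAr.
- by move=> k i neqk; rewrite /W1 /WB [k \in _ :: _]in_cons (negPf neqk).
Qed.

(** Contraction with [b] turns each [B] into the identity and leaves only the gauges between the [A]
    matrices. *)
Lemma contracted_local_symmetry N (e : seq 'I_N) (s : {ffun 'I_N -> 'I_dA}) :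
  (2 <= N)%N -> uniq e ->
  \tr (\prod_k ((if ord_pred k \in e then tensor_act T A else A) (s k)
                 *m ((if ord_pred k \in e then Y else 1%:M)
                      *m (if k \in e then X else 1%:M))))
    = \tr (\prod_k A (s k)).
Proof.
move=> N2 uniq_e.
transitivity (\tr (\prod_k (ZA e k (s k) *m \sum_j b j *: WB e k j))).
  congr (\tr _); apply: eq_bigr => k _; congr (_ *m _).
  transitivity (sel (ord_pred k \in e) Y *m (\sum_j b j *: B j) *m sel (k \in e) X).
    by rewrite b_id mulmx1.
  rewrite mulmx_sumr mulmx_suml; apply: eq_bigr => j _.
  by rewrite -scalemxAr -scalemxAl.
rewrite contract_mpv_sites iter_local_symmetry //.
rewrite -(contract_mpv_sites (fun=> A) (fun=> B)).
by congr (\tr _); apply: eq_bigr => k _; rewrite b_id mulmx1.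
Qed.

Hypothesis YX : Y *m X = 1%:M.

Lemma global_op_mpv d D' (O : 'M[C]_d) (M : tensor R d D') N :
  global_op O (mpv M N) = mpv (tensor_act O M) N.
Proof.
apply/ffunP => s; rewrite !ffunE /tensor_act bigA_distr_bigA raddf_sum /=.
by apply: eq_bigr => t _; rewrite !ffunE -mxtraceZ -prod_scale.
Qed.

Lemma global_symmetry_of_local : global_symmetry A T.
Proof.
have symN N : (1 < N)%N -> mpv (tensor_act T A) N = mpv A N.
  move=> N2; apply/ffunP => s; rewrite !ffunE.
  (* With all sites in [e], every contracted B-site carries [Y X = 1]. *)
  rewrite -(contracted_local_symmetry s N2 (enum_uniq 'I_N)).
  congr (\tr _); apply: eq_bigr => k _.
  by rewrite !mem_enum /= YX mulmx1.
move=> N; rewrite global_op_mpv.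
case: N => [|[|N]]; last exact: symN.
  by apply/ffunP => s; rewrite !ffunE !big_ord0.
apply/ffunP => s; rewrite !ffunE !big_ord1.
(* Length 1: constant configurations on longer chains give the power traces of both matrices. *)
apply: eq_mxtrace_of_powers => k k2.
have /ffunP/(_ [ffun=> s ord0]) := symN k k2; rewrite !ffunE.
under eq_bigr do rewrite ffunE.
under [X in _ = \tr X -> _]eq_bigr do rewrite ffunE.
by rewrite !prodr_const card_ord.
Qed.

(** The symmetry is applied at the last site only. By periodicity it transforms the first letter,
    and cyclicity of the trace brings the final [X] to the front. As [u] is nonempty, the chain has
    length at least 2. *)
Lemma first_site_symmetry (i : 'I_dA) (u : seq 'I_dA) : u != [::] ->
  \tr (X *m tensor_act T A i *m Y *m \prod_(j <- u) A j)
    = \tr (A i *m \prod_(j <- u) A j).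
Proof.
case: u => // j u _; set w := j :: u.
pose s : {ffun 'I_(size w).+1 -> 'I_dA} := [ffun k => nth i (i :: w) (val k)].
have sS k : s (lift ord0 k) = nth i w k by rewrite ffunE.
have prodw : \prod_(j <- w) A j = \prod_(k < size w) A (s (lift ord0 k)).
  by rewrite (big_nth i) big_mkord; apply: eq_bigr => k _; rewrite sS.
have := contracted_local_symmetry s (isT : 1 < (size w).+1)%N (isT : uniq [:: ord_max]).
have ordS_max : ordS ord_max = ord0 :> 'I_(size w).+1.
  by apply: val_inj; rewrite /= modnn.
under eq_bigr => k _ do
  rewrite !inE (can2_eq (@ord_predK _) (@ordSK _)) ordS_max.
rewrite big_ord_recl /= mulmx1.
have -> : \prod_(k < size w)
     ((if lift ord0 k == ord0 then tensor_act T A else A) (s (lift ord0 k))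
        *m ((if lift ord0 k == ord0 then Y else 1%:M)
             *m (if lift ord0 k == ord_max then X else 1%:M)))
    = (\prod_(j <- w) A j) *m X.
  rewrite prodw !big_ord_recr /= -!mulmxE -[in RHS]mulmxA; congr (_ *m _).
    apply: eq_bigr => k _; rewrite !mul1mx ifN ?mulmx1 //.
    by rewrite -val_eqE /= /bump /= add1n eqSS ltn_eqF.
  by rewrite mul1mx ifT // -val_eqE.
have s0 : s ord0 = i by rewrite ffunE.
rewrite s0 -!mulmxE mulmxA mxtrace_mulC !mulmxA => ->.
by rewrite big_ord_recl s0 prodw.
Qed.

End Symmetry.
End LocalToGlobal.

(** * Canonical forms *)

Lemma mul_mxdiag (F : nzRingType) p (p_ : 'I_p -> nat) (M N : forall i, 'M[F]_(p_ i)) :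
  \mxdiag_i M i *m \mxdiag_i N i = \mxdiag_i (M i *m N i).
Proof.
rewrite [X in _ *m X]/mxdiag mul_mxdiag_mxblock; apply/eq_mxblockP => i j.
case: (eqVneq i j) => [eij|_]; last by rewrite mulmx0.
by case: j / eij; rewrite !conform_mx_id.
Qed.

Lemma scale_mxdiag (F : comNzRingType) p (p_ : 'I_p -> nat) a
    (M : forall i, 'M[F]_(p_ i)) :
  a *: \mxdiag_i M i = \mxdiag_i (a *: M i).
Proof.
rewrite -mul_scalar_mx -mxdiagZ mul_mxdiag; apply: eq_mxdiag => i.
exact: mul_scalar_mx.
Qed.

Section BlockDiag.
Variables (R : realType) (m : nat) (r D : 'I_m -> nat).
Local Notation C := R[i].
Implicit Types M N : forall j, 'I_(r j) -> 'M[C]_(D j).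

Lemma eq_block_diag M N : (forall j q, M j q = N j q) -> block_diag M = block_diag N.
Proof. by move=> MN; apply: eq_mxdiag => j; apply: eq_mxdiag => q. Qed.

Lemma block_diagM M N :
  block_diag M *m block_diag N = block_diag (fun j q => M j q *m N j q).
Proof. by rewrite mul_mxdiag; apply: eq_mxdiag => j; rewrite mul_mxdiag. Qed.

Lemma block_diagB M N :
  block_diag M - block_diag N = block_diag (fun j q => M j q - N j q).
Proof. by rewrite -mxdiagB; apply: eq_mxdiag => j; rewrite mxdiagB. Qed.

Lemma block_diagZ a M : a *: block_diag M = block_diag (fun j q => a *: M j q).
Proof. by rewrite scale_mxdiag; apply: eq_mxdiag => j; rewrite scale_mxdiag. Qed.

Lemma block_diag_sum (I : finType) (M : I -> forall j, 'I_(r j) -> 'M[C]_(D j)) :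
  \sum_i block_diag (M i) = block_diag (fun j q => \sum_i M i j q).
Proof. by rewrite -mxdiag_sum; apply: eq_mxdiag => j; rewrite mxdiag_sum. Qed.

Lemma block_diag0 : block_diag (fun j (q : 'I_(r j)) => 0 : 'M[C]_(D j)) = 0.
Proof.
rewrite -[RHS]mxdiag0; apply: eq_mxdiag => j; exact: mxdiag0.
Qed.

Lemma block_diag_scalar a :
  block_diag (fun j (q : 'I_(r j)) => a%:M : 'M[C]_(D j)) = a%:M.
Proof.
rewrite -[RHS]mxdiagZ; apply: eq_mxdiag => j; exact: mxdiagZ.
Qed.

Lemma mxtrace_block_diag M : \tr (block_diag M) = \sum_j \sum_q \tr (M j q).
Proof. by rewrite mxtrace_mxdiag; apply: eq_bigr => j _; rewrite mxtrace_mxdiag. Qed.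

End BlockDiag.

(** * Gauge symmetry of a tensor in canonical form *)

Section CanonicalForm.
Variables (R : realType) (m : nat) (r D : 'I_m -> nat) (d : nat).
Local Notation C := R[i].
Variables (A : tensor R d (bdim r D)) (nu : forall j, 'I_(r j) -> C).
Variable (As : forall j, tensor R d (D j)).
Arguments nu : clear implicits.
Hypothesis CF_A : in_CF A nu As.
Variables (T : 'M[C]_d) (Xs Ys : forall j, 'M[C]_(D j)).
Let X : 'M[C]_(bdim r D) := block_diag (fun j (q : 'I_(r j)) => Xs j).
Let Y : 'M[C]_(bdim r D) := block_diag (fun j (q : 'I_(r j)) => Ys j).
Hypothesis first_site : forall i (u : seq 'I_d), u != [::] ->
  \tr (X *m tensor_act T A i *m Y *m \prod_(j <- u) A j)
    = \tr (A i *m \prod_(j <- u) A j).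

Let defect j i : 'M[C]_(D j) := Xs j *m tensor_act T (As j) i *m Ys j - As j i.

(** Block [j] has at least one copy, which is equivalent to [As j]; uniqueness in the BNT excludes
    equivalence with another [As k]. *)
Lemma CF_words_separate j k : k != j -> words_separate As j k.
Proof.
case: CF_A => r0 _ _ [normalA uniqA] nekj; apply: normal_words_separate => // gjk.
have [j' [_ uj']] := uniqA (Tagged _ (Ordinal (r0 j)) : {j : 'I_m & 'I_(r j)}).
move: nekj; rewrite -(uj' k) // (uj' j) ?eqxx //.
exact: gauge_equivalent_refl.
Qed.

Lemma block_defectE i :
  X *m tensor_act T A i *m Y - A i = block_diag (fun j q => nu j q *: defect j i).
Proof.
case: CF_A => _ _ AE _; rewrite /tensor_act AE.
under eq_bigr do rewrite AE block_diagZ.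
rewrite block_diag_sum !block_diagM block_diagB; apply: eq_block_diag => j q.
rewrite scalerBr; congr (_ - _); rewrite scalemxAl scalemxAr; congr (_ *m _ *m _).
by rewrite scaler_sumr; apply: eq_bigr => i' _; rewrite !scalerA mulrC.
Qed.

(** A word of length [L] in [A] carries the factor [nu j q ^+ L] on block [j, q]. Induction on [L]
    moves the letters of [z] into the word [u] until a scalar remains. *)
Lemma mxtrace_defect_word_span i L z (u : seq 'I_d) : word_span As L z ->
  (0 < size u + L)%N ->
  \tr ((X *m tensor_act T A i *m Y - A i) *m (\prod_(j <- u) A j *m
    block_diag (fun j q => nu j q ^+ L *: z j))) = 0.
Proof.
case: CF_A => _ _ AE _; set Delta := _ - A i.
have tr_word v : v != [::] -> \tr (Delta *m \prod_(j <- v) A j) = 0.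
  by move=> v0; rewrite mulmxBl raddfB /= first_site ?subrr.
clearbody Delta.
elim: L u z => [|L IHL] u z /=.
  move=> [c zc]; rewrite addn0 => u0.
  rewrite (@eq_block_diag _ _ _ _ _ (fun j q => c%:M)); last first.
    by move=> j q; rewrite scale1r.
  rewrite block_diag_scalar mul_mx_scalar -scalemxAr mxtraceZ.
  by rewrite tr_word ?mulr0 // -size_eq0 -lt0n.
move=> [y [spy zE]] _.
have -> : block_diag (fun j q => nu j q ^+ L.+1 *: z j)
    = \sum_i' A i' *m block_diag (fun j q => nu j q ^+ L *: y i' j).
  under eq_bigr do rewrite AE block_diagM.
  rewrite block_diag_sum; apply: eq_block_diag => j q.
  rewrite zE scaler_sumr; apply: eq_bigr => i' _.
  by rewrite -scalemxAl -scalemxAr scalerA exprS.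
rewrite !mulmx_sumr raddf_sum big1 // => i' _ /=.
rewrite [\prod_(j <- u) _ *m _]mulmxA.
have -> : \prod_(j <- u) A j *m A i' = \prod_(j <- rcons u i') A j.
  by rewrite -cats1 big_cat big_seq1.
by apply: (IHL (rcons u i') (y i')) => //; rewrite size_rcons addSn.
Qed.

Lemma CF_symmetry i : X *m tensor_act T A i *m Y = A i.
Proof.
apply/eqP; rewrite -subr_eq0 block_defectE -(block_diag0 R r D); apply/eqP.
apply: eq_block_diag => j q; suff -> : defect j i = 0 by rewrite scaler0.
case: (CF_A) => r0 nun0 _ [normalA _].
have [L0 fullj] := normal_full_at normalA j.
have [L1 isoj] := isolated_span fullj (@CF_words_separate j).
(* One factor [nu] belongs to the defect and the others to the word; [L1.+2] keeps the word longer
   than [L1], hence nonempty. *)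
have [|L leL nuL] := @power_sum_neq0 C _ (nu j) L1.+2 _ (nun0 j).
  by rewrite card_ord.
case: L leL nuL => // L; rewrite ltnS => leL nuL.
suff trdef x : \tr (x *m defect j i) = 0.
  apply/matrixP => a b; rewrite [RHS]mxE.
  (* The matrix unit [E_ba], factored as column times row, reads off the entry [a b]. *)
  have := trdef (delta_mx b (0 : 'I_1) *m delta_mx 0 a).
  rewrite -mulmxA mxtrace_mulC delta_mx_sandwich mxtraceZ.
  by rewrite /mxtrace big_ord1 [delta_mx _ _ _ _]mxE !eqxx mulr1.
have [z [spz zj zk]] := isoj L (ltnW leL) x.
have := mxtrace_defect_word_span i (u := [::]) spz.
rewrite big_nil mul1mx block_defectE block_diagM mxtrace_block_diag.
rewrite (bigD1 j) //= [X in _ + X]big1 ?addr0; last first.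
  by move=> k nekj; rewrite big1 // => q' _; rewrite zk // scaler0 mulmx0 linear0.
rewrite zj add0n (leq_trans _ leL) // => /(_ isT) sum0.
apply: (mulfI nuL); rewrite mulr0 -[RHS]sum0 mulr_suml; apply: eq_bigr => q' _.
by rewrite -scalemxAl -scalemxAr scalerA -exprS mxtraceZ (mxtrace_mulC x).
Qed.

End CanonicalForm.

Theorem proposition6
  (R : realType) (G : topologicalGroupType)
  (hG : finite_or_compact_lie_group R G)
  (gamma : G -> G -> R[i]) (hgamma : multiplier gamma)
  (dB : nat) (RR LL : G -> 'M[R[i]]_dB)
  (hRR : projective_unitary_rep gamma RR)
  (hLL : projective_unitary_rep (fun g h => (gamma g h)^-1) LL)
  (m : nat) (r D : 'I_m -> nat)
  (B : tensor R dB (bdim r D))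
  (mu : forall j, 'I_(r j) -> R[i]) (Bs : forall j, tensor R dB (D j))
  (hB : in_CFII B mu Bs)
  (hBsym : forall g, local_symmetry2 B (RR g) (LL g))
  (Xs : forall j, G -> 'M[R[i]]_(D j))
  (X : G -> 'M[R[i]]_(bdim r D))
  (hXs : forall g, X g = block_diag (fun j (q : 'I_(r j)) => Xs j g))
  (hX : projective_rep gamma X)
  (hRX : forall g i, \sum_i' RR g i i' *: B i' = B i *m X g)
  (hLX : forall g i, \sum_i' LL g i i' *: B i' = invmx (X g) *m B i)
  (hspan : 1%:M \in <<codom B>>%VS)
  (dA : nat) (A : tensor R dA (bdim r D))
  (Theta : G -> 'M[R[i]]_dA) (hTheta : unitary_rep Theta)
  (hABsym : forall g, local_symmetry3 A B (RR g) (Theta g) (LL g)) :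
  (forall g, global_symmetry A (Theta g)) /\
  (forall (nu : forall j, 'I_(r j) -> R[i]) (As : forall j, tensor R dA (D j)),
     in_CF A nu As ->
     forall g i,
       \sum_i' Theta g i i' *: A i' = invmx (X g) *m A i *m X g).
Proof.
have uX g : X g \in unitmx by case: hX.
have [b b_id] := memv_span_codom hspan.
split=> [g|nu As CF_A g i].
  exact: (global_symmetry_of_local (hRX g) (hLX g) b_id (@hABsym g) (mulVmx (uX g))).
(* Up to the phase [gamma g g^-1], [X g^-1] inverts [X g]; so the inverse is block diagonal with the
   same matrix on all copies of a block. *)
pose Ys j := (gamma g g^-1%g)^-1 *: Xs j g^-1%g.
have YE : invmx (X g) = block_diag (fun j (q : 'I_(r j)) => Ys j).
  have [gamma1 _ gamma_e _] := hgamma; have [_ XM] := hX.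
  have X1 : X 1%g = 1%:M.
    have := XM 1%g 1%g; rewrite mulg1 (proj1 (gamma_e _)) scale1r.
    by move=> /(congr1 (mulmx (invmx (X 1%g)))); rewrite mulKmx // mulVmx.
  rewrite -block_diagZ -hXs; apply: (can_inj (mulKmx (uX g))).
  rewrite mulmxV // -scalemxAr XM mulgV X1 scalerA mulVf ?scale1r //.
  by rewrite -normr_eq0 gamma1 oner_eq0.
have : X g *m tensor_act (Theta g) A i *m invmx (X g) = A i.
  rewrite YE hXs; apply: (CF_symmetry CF_A) => i' u u0; rewrite -hXs -YE.
  exact: (first_site_symmetry (hRX g) (hLX g) b_id (@hABsym g)).
move=> /(congr1 (mulmxr (X g))) /=; rewrite mulmxKV // => XA.
by rewrite -mulmxA -XA mulKmx.
Qed.
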